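(* Let $K$ be a number field with ring of integers $\mathcal{O}_K$, and let $\alpha \in \mathcal{O}_K$ be non-zero with $n(\alpha) = 2$, where $n(\alpha)$ is the number of principal ideal divisors of $(\alpha)$. Then $\alpha$ is irreducible in $\mathcal{O}_K$.
   Context: For a non-zero $\alpha \in \mathcal{O}_K$ with prime ideal factorization $(\alpha) = \mathfrak{p}_1^{e_1} \cdots \mathfrak{p}_g^{e_g}$ (distinct primes), an ideal divisor of $(\alpha)$ is an ideal of the form $J = \prod_{i=1}^g \mathfrak{p}_i^{f_i}$ with $0 \le f_i \le e_i$; it is a principal ideal divisor if $J = (a)$ for some $a \in \mathcal{O}_K$. The ideals $\mathcal{O}_K = (1)$ and $(\alpha)$ itself count as principal ideal divisors. *)

(* Defs.v *)
From HB Require Import structures.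
From mathcomp Require Import all_boot all_order all_algebra all_field.
From mathcomp Require Import ring_quotient finmap.
From mathcomp Require Import boolp classical_sets cardinality.

Set Implicit Arguments.
Unset Strict Implicit.
Unset Printing Implicit Defensive.

Import GRing.Theory.

Local Open Scope ring_scope.
Local Open Scope classical_set_scope.

(* A number field is a [fieldExtType rat], i.e. a finite extension of Q. *)
Definition integral_pred (K : fieldExtType rat) : {pred K} :=
  fun x => `[< integralOver (intr : int -> K) x >].

Arguments integral_pred : clear implicits.

Lemma integral_predP (K : fieldExtType rat) (x : K) :
  reflect (integralOver (intr : int -> K) x) (x \in integral_pred K).
Proof. exact: asboolP. Qed.

Lemma integral_pred_subring (K : fieldExtType rat) :
  subring_closed (integral_pred K).
Proof.
split; first exact/integral_predP/integral1.
- by move=> x y /integral_predP Hx /integral_predP Hy;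
    apply/integral_predP; apply: integral_sub.
- by move=> x y /integral_predP Hx /integral_predP Hy;
    apply/integral_predP; apply: integral_mul.
Qed.

HB.instance Definition _ (K : fieldExtType rat) :=
  GRing.isSubringClosed.Build K (integral_pred K) (integral_pred_subring K).

Record ring_of_integers (K : fieldExtType rat) : Type := RingOfIntegers {
  roi_val : K;
  roi_valP : roi_val \in integral_pred K
}.

Section RingOfIntegers.
Variable K : fieldExtType rat.
Local Notation OK := (ring_of_integers K).

HB.instance Definition _ := [isSub for @roi_val K].
HB.instance Definition _ := [Choice of OK by <:].
HB.instance Definition _ := [SubChoice_isSubComNzRing of OK by <:].

Definition roi_unit : {pred OK} :=
  fun x => (val x != 0) && ((val x)^-1 \in integral_pred K).

Definition roi_inv (x : OK) : OK := insubd x (val x)^-1.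

Lemma roi_mulVx : {in roi_unit, left_inverse 1 roi_inv *%R}.
Proof.
move=> x /andP[x0 xV]; apply: val_inj.
by rewrite rmorphM rmorph1 /= insubdK // mulVf.
Qed.

Lemma roi_unitPl (x y : OK) : y * x = 1 -> roi_unit x.
Proof.
move=> /(congr1 val); rewrite rmorphM rmorph1 /= => yx.
have x0 : val x != 0.
  by apply/eqP => x0; move/eqP: yx; rewrite x0 mulr0 eq_sym oner_eq0.
rewrite /roi_unit x0 /=.
by rewrite -[_^-1]mul1r -yx mulfK //; apply: valP.
Qed.

Lemma roi_invr_out : {in [predC roi_unit], roi_inv =1 id}.
Proof.
move=> x; rewrite !inE => xN; apply: val_inj; rewrite /roi_inv val_insubd.
case: ifPn => // xV; move: xN; rewrite /in_mem /= /roi_unit xV andbT negbK.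
by move=> /eqP ->; rewrite invr0.
Qed.

HB.instance Definition _ :=
  GRing.ComNzRing_hasMulInverse.Build OK roi_mulVx roi_unitPl roi_invr_out.

Lemma roi_idomain (x y : OK) : x * y = 0 -> (x == 0) || (y == 0).
Proof.
by move=> /(congr1 val) /eqP; rewrite rmorphM rmorph0 mulf_eq0 -!val_eqE.
Qed.

HB.instance Definition _ := GRing.ComUnitRing_isIntegral.Build OK roi_idomain.

End RingOfIntegers.

Definition irreducible_elt (R : idomainType) (a : R) : Prop :=
  [/\ a != 0, a \isn't a GRing.unit
    & forall b c : R, a = b * c -> b \is a GRing.unit \/ c \is a GRing.unit].

Section Ideals.
Variable R : comNzRingType.
Implicit Types I J P : set R.

Definition principal_ideal (a : R) : set R := range ( *%R a).

Definition is_principal I : Prop := exists a : R, I = principal_ideal a.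

(* [idealr_closed] includes [1 \notin P]. *)
Definition prime_ideal P : Prop :=
  idealr_closed (mem P) /\ prime_idealr_closed (mem P).

Definition ideal_mul I J : set R :=
  [set x | exists2 s : seq (R * R),
     (forall u, u \in s -> I u.1 /\ J u.2) & x = \sum_(u <- s) u.1 * u.2].

Definition ideal_exp I (n : nat) : set R := iter n (ideal_mul I) [set: R].

Definition ideal_prod (g : nat) (p : 'I_g -> set R) (e : 'I_g -> nat) : set R :=
  \big[ideal_mul/[set: R]]_(i < g) ideal_exp (p i) (e i).

Definition prime_factorization I (g : nat) (p : 'I_g -> set R)
    (e : 'I_g -> nat) : Prop :=
  [/\ forall i, prime_ideal (p i), injective p, forall i, (0 < e i)%N
    & I = ideal_prod p e].

(* Factorizations into primes being unique in a Dedekind domain up to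
   reordering, it does not matter which factorization of [(a)] is used. *)
Definition ideal_divisor (a : R) J : Prop :=
  exists (g : nat) (p : 'I_g -> set R) (e f : 'I_g -> nat),
    [/\ prime_factorization (principal_ideal a) p e,
        forall i, (f i <= e i)%N
      & J = ideal_prod p f].

Definition principal_ideal_divisors (a : R) : set (set R) :=
  [set J | ideal_divisor a J /\ is_principal J].

(* [fset_set] sends an infinite set to the empty one; for [a != 0] in a
   Dedekind domain the set counted here is finite. *)
Definition num_principal_ideal_divisors (a : R) : nat :=
  #|` fset_set (principal_ideal_divisors a)|%N.

End Ideals.

(* Main.v *)
Require Import Defs.
From mathcomp Require Import all_boot all_order all_algebra all_field.
From mathcomp Require Import finmap.
From mathcomp Require Import boolp classical_sets cardinality.

(** If [alpha = b * c] with neither factor a unit, then [(1)], [(b)] and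
    [(alpha)] are three distinct principal ideal divisors. That [(b)] is an ideal
    divisor needs no Dedekind theory: a count of two already supplies some prime
    factorization of [(alpha)], every prime in it is invertible because it divides
    a nonzero principal ideal, and in any domain a factor of a product of
    invertible primes is a subproduct, by cancelling the primes one at a time. *)

Set Implicit Arguments.
Unset Strict Implicit.
Unset Printing Implicit Defensive.

Import GRing.Theory.

Local Open Scope ring_scope.
Local Open Scope classical_set_scope.

(** * Products of ideals in a commutative ring *)

Section IdealMul.
Variable R : comNzRingType.
Implicit Types (I J L P : set R) (x y r : R).

(* Unlike [idealr_closed], this allows the unit ideal. *)
Definition is_ideal I : Prop :=
  [/\ I 0, forall x y, I x -> I y -> I (x + y) & forall r x, I x -> I (r * x)].

Lemma mem_ideal_mul I J x y : I x -> J y -> ideal_mul I J (x * y).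
Proof.
move=> Ix Jy; exists [:: (x, y)]; last by rewrite big_seq1.
by move=> u; rewrite inE => /eqP ->.
Qed.

Lemma ideal_mul0 I J : ideal_mul I J 0.
Proof. by exists [::] => //; rewrite big_nil. Qed.

Lemma ideal_mulD I J x y :
  ideal_mul I J x -> ideal_mul I J y -> ideal_mul I J (x + y).
Proof.
move=> [s Hs ->] [t Ht ->]; exists (s ++ t); last by rewrite big_cat.
by move=> u; rewrite mem_cat => /orP[/Hs|/Ht].
Qed.

(** Elimination principle behind most inclusions out of a product: elements of [ideal_mul I J] are
    finite sums of products. *)
Lemma ideal_mul_sub I J L : L 0 -> (forall x y, L x -> L y -> L (x + y)) ->
  (forall x y, I x -> J y -> L (x * y)) -> ideal_mul I J `<=` L.
Proof.
move=> L0 LD LIJ _ [s Hs ->]; rewrite big_seq; elim/big_ind: _ => // u /Hs[].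
exact: LIJ.
Qed.

Lemma ideal_mulC : commutative (@ideal_mul R).
Proof.
move=> I J; apply/seteqP; split; apply: ideal_mul_sub;
  by [exact: ideal_mul0 | exact: ideal_mulD
     | move=> x y ? ?; rewrite mulrC; exact: mem_ideal_mul].
Qed.

Lemma ideal_mulA_sub I J L :
  ideal_mul I (ideal_mul J L) `<=` ideal_mul (ideal_mul I J) L.
Proof.
apply: ideal_mul_sub; [exact: ideal_mul0 | exact: ideal_mulD |].
move=> x _ Ix [s Hs ->]; rewrite mulr_sumr big_seq.
elim/big_ind: _; [exact: ideal_mul0 | exact: ideal_mulD |].
move=> u /Hs[Ju Lu]; rewrite mulrA.
by apply: mem_ideal_mul => //; apply: mem_ideal_mul.
Qed.

Lemma ideal_mulA : associative (@ideal_mul R).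
Proof.
move=> I J L; apply/seteqP; split; first exact: ideal_mulA_sub.
(* Commutativity turns the reverse inclusion into [ideal_mulA_sub] for [L], [J], [I]. *)
rewrite (ideal_mulC _ L) (ideal_mulC I J) (ideal_mulC I) (ideal_mulC J L).
exact: ideal_mulA_sub.
Qed.

Lemma ideal_mulCA : left_commutative (@ideal_mul R).
Proof. by move=> I J L; rewrite !ideal_mulA (ideal_mulC I). Qed.

Lemma ideal_mulS I J L : J `<=` L -> ideal_mul I J `<=` ideal_mul I L.
Proof.
move=> JL; apply: ideal_mul_sub; [exact: ideal_mul0 | exact: ideal_mulD |].
by move=> x y Ix /JL; apply: mem_ideal_mul.
Qed.

Lemma ideal_mul_subl I J : is_ideal I -> ideal_mul I J `<=` I.
Proof.
case=> I0 ID IM; apply: ideal_mul_sub => // x y Ix _.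
by rewrite mulrC; apply: IM.
Qed.

Lemma is_ideal_mul I J : is_ideal I -> is_ideal (ideal_mul I J).
Proof.
case=> _ _ IM; split; [exact: ideal_mul0 | exact: ideal_mulD |].
move=> r _ [s Hs ->]; rewrite mulr_sumr big_seq.
elim/big_ind: _; [exact: ideal_mul0 | exact: ideal_mulD |].
by move=> u /Hs[Iu Ju]; rewrite mulrA; apply: mem_ideal_mul => //; apply: IM.
Qed.

Lemma is_ideal_principal r : is_ideal (principal_ideal r).
Proof.
split; first by exists 0; rewrite ?mulr0.
- by move=> _ _ [x _ <-] [y _ <-]; exists (x + y); rewrite ?mulrDr.
- by move=> s _ [x _ <-]; exists (s * x); rewrite // mulrCA.
Qed.

Lemma is_ideal_prime P : prime_ideal P -> is_ideal P.
Proof.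
case=> -[P0 _ PD] _; split.
- by move: P0; rewrite inE.
- move=> x y Px Py; have := PD 1 x y.
  by rewrite !inE mul1r; apply.
- move=> r x Px; have := PD r x 0.
  by move: P0; rewrite !inE addr0 => P0; apply.
Qed.

Lemma prime_ideal_not1 P : prime_ideal P -> ~ P 1.
Proof. by case=> -[_ /negP P1 _] _ /mem_set. Qed.

(** An [x] in [I] outside [P] forces each [y] in [J] into [P], since [x * y] is in [P]. *)
Lemma prime_ideal_mul_sub P I J : prime_ideal P ->
  ideal_mul I J `<=` P -> I `<=` P \/ J `<=` P.
Proof.
case=> _ Pprime IJP; apply/or_asboolP; rewrite -implyNb; apply/implyP.
move=> /asboolPn/existsNP[x /not_implyP[Ix NPx]]; apply/asboolP => y Jy.
have /mem_set/Pprime/orP[/set_mem//|/set_mem//] := IJP _ (mem_ideal_mul Ix Jy).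
Qed.

(** This reduces cancelling a principal ideal to the injectivity of multiplication by [r]. *)
Lemma ideal_mul_principal r I : is_ideal I ->
  ideal_mul (principal_ideal r) I = ( *%R r) @` I.
Proof.
move=> II; have [I0 ID IM] := II; apply/seteqP; split.
- apply: ideal_mul_sub.
  + by exists 0; rewrite ?mulr0.
  + move=> _ _ [x Ix <-] [y Iy <-].
    by exists (x + y); rewrite ?mulrDr //; apply: ID.
  + by move=> _ y [x _ <-] Iy; exists (x * y); [apply: IM | rewrite mulrA].
- move=> _ [x Ix <-]; apply: mem_ideal_mul => //.
  by exists 1; rewrite ?mulr1.
Qed.

Lemma principal_idealM x y :
  principal_ideal (x * y) = ideal_mul (principal_ideal x) (principal_ideal y).
Proof.
rewrite (ideal_mul_principal _ (is_ideal_principal y)) image_comp.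
by apply: eq_imagel => z _ /=; rewrite mulrA.
Qed.

Lemma is_ideal_prod g (p : 'I_g -> set R) e : is_ideal (ideal_prod p e).
Proof.
rewrite /ideal_prod; elim/big_ind: _ => // [I J II _|i _]; first exact: is_ideal_mul.
rewrite /ideal_exp; case: (e i) => [//|n] /=.
(* The ideal property starts from the unit ideal at the bottom of [ideal_exp]; commuting puts the
   smaller power on the left, as [is_ideal_mul] wants. *)
elim: n => [|n IHn] /=; rewrite ideal_mulC; exact: is_ideal_mul.
Qed.

(* Index-list induction: [ideal_mul] has [setT] as identity only on ideals, so
   the monoid lemmas on big operators do not apply. *)
Lemma ideal_prodS g (p : 'I_g -> set R) e i :
  ideal_prod p (fun j => ((j == i) + e j)%N) = ideal_mul (p i) (ideal_prod p e).
Proof.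
rewrite /ideal_prod; have := mem_index_enum i; have := index_enum_uniq 'I_g.
elim: (index_enum _) => [//|j s IHs] /= /andP[js us]; rewrite inE !big_cons.
have [ij _|/= ij /(IHs us) ->] := eqVneq i j; last first.
  by rewrite ideal_mulCA.
rewrite {}ij -ideal_mulA in js *; congr (ideal_mul _ (ideal_mul _ _)).
apply: eq_big_seq => k ks; case: eqP => // ki.
by move: js; rewrite -ki ks.
Qed.

(** Positivity of [e i] makes the truncated subtraction exact. *)
Lemma ideal_prod_dec g (p : 'I_g -> set R) e i : (0 < e i)%N ->
  ideal_prod p e = ideal_mul (p i) (ideal_prod p (fun j => e j - (j == i))%N).
Proof.
move=> ei; rewrite -ideal_prodS; congr ideal_prod; apply/funext => j.
by case: eqP => [->|]; rewrite ?subn0 ?subnKC.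
Qed.

Lemma ideal_prod0 g (p : 'I_g -> set R) : ideal_prod p (fun=> 0%N) = [set: R].
Proof.
rewrite /ideal_prod; elim/big_ind: _ => // I J -> ->.
by apply/seteqP; split=> // x _; rewrite -(mulr1 x); apply: mem_ideal_mul.
Qed.

End IdealMul.

(** * Invertible ideals and factorizations in a domain *)

Section Domain.
Variable R : idomainType.
Implicit Types (I J A B P Q : set R) (a b c d x y : R).

(** The fractional inverse of [I] is [Q / d]; clearing the denominator keeps everything inside
    [R]. *)
Definition invertible_ideal I : Prop :=
  exists Q d, d != 0 /\ ideal_mul I Q = principal_ideal d.

Lemma ideal_mul_principalI d A B : d != 0 -> is_ideal A -> is_ideal B ->
  ideal_mul (principal_ideal d) A = ideal_mul (principal_ideal d) B -> A = B.
Proof.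
move=> d0 IA IB; rewrite !ideal_mul_principal // => dAB; apply/funext => x.
by rewrite -(image_inj (mulfI d0)) dAB (image_inj (mulfI d0)).
Qed.

(** Multiplying by [Q] replaces [I] by the principal ideal of [d], which cancels. *)
Lemma invertible_idealI I A B : invertible_ideal I -> is_ideal A -> is_ideal B ->
  ideal_mul I A = ideal_mul I B -> A = B.
Proof.
move=> [Q [d [d0 IQ]]] IA IB /(congr1 (ideal_mul Q)).
by rewrite !ideal_mulA (ideal_mulC Q) IQ; apply: ideal_mul_principalI.
Qed.

(* To contain is to divide: the quotient is [A Q / d], where [I Q = (d)]. *)
Lemma invertible_ideal_dvd I A : invertible_ideal I -> is_ideal A -> A `<=` I ->
  exists2 A', is_ideal A' & A = ideal_mul I A'.
Proof.
move=> [Q [d [d0 IQ]]] IA AI; have [AQ0 AQD AQM] := is_ideal_mul Q IA.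
have IA' : is_ideal [set x | ideal_mul A Q (d * x)].
  split=> /=; first by rewrite mulr0.
  - by move=> x y; rewrite mulrDr; apply: AQD.
  - by move=> r x; rewrite mulrCA; apply: AQM.
exists [set x | ideal_mul A Q (d * x)] => //.
have dA' : ideal_mul (principal_ideal d) [set x | ideal_mul A Q (d * x)] =
    ideal_mul A Q.
  rewrite ideal_mul_principal //; apply/seteqP; split; first by move=> _ [x ? <-].
  (* Since [A] lies in [I], [A Q] lies in [I Q = (d)], so [d] divides [y]. *)
  move=> y AQy; have : principal_ideal d y.
    by rewrite -IQ; move: AQy; rewrite !(ideal_mulC _ Q); apply: ideal_mulS.
  by case=> x _ xy; exists x => //=; rewrite xy.
apply: (ideal_mul_principalI d0) => //.
  by rewrite ideal_mulC; apply: is_ideal_mul.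
by rewrite ideal_mulCA dA' -IQ -ideal_mulA (ideal_mulC A).
Qed.

(** Induction on the sum of the exponents. A prime [p i] with [e i] positive contains [A B], hence
    [A] or [B]; it is divided out of that factor and cancelled. Only when it came from [A] does it
    go back into [f]. *)
Lemma factor_ideal_prod g (p : 'I_g -> set R) e A B :
  (forall i, prime_ideal (p i)) -> (forall i, invertible_ideal (p i)) ->
  is_ideal A -> is_ideal B -> ideal_mul A B = ideal_prod p e ->
  exists2 f, (forall i, (f i <= e i)%N) & A = ideal_prod p f.
Proof.
move=> pP pV; have [n] := ubnP (\sum_i e i).
elim: n e A B => // n IHn e A B le_e IA IB ABe.
have [[i ei]|e0] := pselect (exists i, (0 < e i)%N); last first.
  have {}e0 : e = fun=> 0%N.
    by apply/funext => i; apply/eqP; rewrite -leqn0 leqNgt; apply/negP => ei;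
      apply: e0; exists i.
  (* Here [A B] is the unit ideal, and [A] contains it. *)
  exists (fun=> 0%N) => //; rewrite ideal_prod0; apply/seteqP; split=> // x _.
  by apply: (ideal_mul_subl IA (J := B)); rewrite ABe e0 ideal_prod0.
set e' := fun j => (e j - (j == i))%N.
have le_e' j : (e' j <= e j)%N by apply: leq_subr.
have lt_e' : (\sum_j e' j < n)%N.
  rewrite -ltnS; apply: leq_trans le_e.
  rewrite ltnS [in ltnRHS](bigD1 i) //= (bigD1 i) //=.
  by rewrite /e' eqxx subn1 -addSn prednK // leq_add2l; apply: leq_sum => j _; apply: leq_subr.
have Ipi := is_ideal_prime (pP i).
have Ie' := is_ideal_prod p e'.
have ABpi : ideal_mul A B = ideal_mul (p i) (ideal_prod p e').
  by rewrite ABe (ideal_prod_dec _ ei).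
have : ideal_mul A B `<=` p i by rewrite ABpi; apply: ideal_mul_subl.
case/(prime_ideal_mul_sub (pP i)).
- move=> /(invertible_ideal_dvd (pV i) IA)[A' IA' defA]; case: (IHn e' A' B) => //.
    apply: (invertible_idealI (pV i)) => //; first exact: is_ideal_mul.
    by rewrite ideal_mulA -defA.
  move=> f fe' defA'; exists (fun j => ((j == i) + f j)%N).
    move=> j; apply: leq_trans (leq_add (leqnn _) (fe' j)) _.
    by rewrite /e'; case: eqP => [->|]; rewrite ?subn0 ?subnKC.
  by rewrite ideal_prodS -defA'.
- move=> /(invertible_ideal_dvd (pV i) IB)[B' IB' defB]; case: (IHn e' A B') => //.
    apply: (invertible_idealI (pV i)) => //; first exact: is_ideal_mul.
    by rewrite ideal_mulCA -defB.
  by move=> f fe' ->; exists f => // j; apply: leq_trans (fe' j) _.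
Qed.

Lemma prime_factorization_dvd g (p : 'I_g -> set R) e b c : b * c != 0 ->
  prime_factorization (principal_ideal (b * c)) p e ->
  ideal_divisor (b * c) (principal_ideal b).
Proof.
move=> bc0 bcpe; have [pP _ e0 bcE] := bcpe.
case: (@factor_ideal_prod g p e (principal_ideal b) (principal_ideal c)) => //.
(* The rest of the factorization serves as [Q], with [d = b * c]. *)
- move=> i; exists (ideal_prod p (fun j => e j - (j == i))%N), (b * c).
  by rewrite -ideal_prod_dec.
- exact: is_ideal_principal.
- exact: is_ideal_principal.
- by rewrite -principal_idealM.
by move=> f fe ->; exists g, p, e, f.
Qed.

(** * Units and the count of principal ideal divisors *)

Lemma principal_ideal_unit a b : a != 0 ->
  principal_ideal a = principal_ideal (a * b) -> b \is a GRing.unit.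
Proof.
move=> a0 ab; have : principal_ideal (a * b) a.
  by rewrite -ab; exists 1; rewrite ?mulr1.
case=> c _; rewrite -[RHS]mulr1 -mulrA => /(mulfI a0) bc.
by apply/unitrPr; exists c.
Qed.

(** A prime occurring in a factorization of the unit ideal would contain 1, so the factorization is
    empty. *)
Lemma principal_ideal_divisors_unit a : a \is a GRing.unit ->
  principal_ideal_divisors a `<=` [set [set: R]].
Proof.
move=> ua _ [[g [p [e [f [[pP _ e0 apE] _ ->]]]]] _] /=.
case: g => [|g] in p e f pP e0 apE *; first by rewrite /ideal_prod big_ord0.
have : ideal_prod p e 1 by rewrite -apE; exists a^-1; rewrite ?divrr.
rewrite (ideal_prod_dec p (e0 ord0)).
move=> /(ideal_mul_subl (is_ideal_prime (pP ord0))).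
by move/(prime_ideal_not1 (pP ord0)).
Qed.

Theorem irreducible_num_principal_ideal_divisors a : a != 0 ->
  num_principal_ideal_divisors a = 2%N -> irreducible_elt a.
Proof.
rewrite /num_principal_ideal_divisors => a0 a2.
(* An infinite set would be counted as 0, not 2. *)
have fin : finite_set (principal_ideal_divisors a).
  by move: a2; rewrite /fset_set; case: pselect => // _; rewrite cardfs0.
have subDa (s : {fset set R}) :
    (forall J, J \in s -> principal_ideal_divisors a J) -> (#|` s| <= 2)%N.
  move=> sD; rewrite -a2; apply/fsubset_leq_card/fsubsetP => J /sD.
  by rewrite in_fset_set // inE.
split=> // [|b c abc].
  apply/negP => /principal_ideal_divisors_unit aT.
  suff : (#|` fset_set (principal_ideal_divisors a)| <= 1)%N by rewrite a2.
  rewrite -(cardfs1 [set: R]); apply/fsubset_leq_card/fsubsetP => J.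
  by rewrite in_fset_set // !inE => /aT ->.
have [g [p [e ape]]] : exists g (p : 'I_g -> set R) e,
    prime_factorization (principal_ideal a) p e.
  have : (0 < #|` fset_set (principal_ideal_divisors a)|)%N by rewrite a2.
  rewrite cardfs_gt0 => /fset0Pn[J]; rewrite in_fset_set // inE.
  by case=> -[g [p [e [f [ape _ _]]]]] _; exists g, p, e.
have divD x y : a = x * y -> principal_ideal_divisors a (principal_ideal x).
  move=> axy; split; last by exists x.
  by rewrite axy in a0 ape *; apply: prime_factorization_dvd ape.
have b0 : b != 0 by apply: contraNneq a0 => b0; rewrite abc b0 mul0r.
apply/orP; rewrite -implyNb; apply/implyP => nub; apply/negPn/negP => nuc.
pose s := [fset principal_ideal 1; principal_ideal b; principal_ideal a]%fset.
have : (#|` s| <= 2)%N.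
  apply: subDa => J; rewrite !inE => /orP[/orP[]|] /eqP ->.
  - by apply: (divD 1 a); rewrite mul1r.
  - exact: divD abc.
  - by apply: (divD a 1); rewrite mulr1.
(* Each coincidence yields a unit: [(1) = (b)] makes [b] one, [(1) = (a)] makes [b * c] and so [b]
   one, and [(b) = (b * c)] makes [c] one. *)
have /negbTE n1b : principal_ideal 1 != principal_ideal b.
  apply: contraNneq nub => E; apply: (principal_ideal_unit (oner_neq0 R)).
  by rewrite mul1r.
have /negbTE n1a : principal_ideal 1 != principal_ideal a.
  apply: contraNneq nub => E.
  have : a \is a GRing.unit.
    by apply: (principal_ideal_unit (oner_neq0 R)); rewrite mul1r.
  by rewrite abc unitrM => /andP[].
have /negbTE nba : principal_ideal b != principal_ideal a.
  by apply: contraNneq nuc => E; apply: (principal_ideal_unit b0); rewrite -abc.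
rewrite /s -fsetUA cardfsU1 cardfs2 !inE.
by rewrite n1b n1a nba.
Qed.

End Domain.

Theorem lemma2 (K : fieldExtType rat) (alpha : ring_of_integers K)
    (alpha_neq0 : alpha != 0)
    (n_alpha : num_principal_ideal_divisors alpha = 2%N) :
  irreducible_elt alpha.
Proof. exact: irreducible_num_principal_ideal_divisors. Qed.
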